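(* Let $\varphi_0,\ldots,\varphi_{p+q}\colon\mathbb{R}^n\to\overline{\mathbb{R}}$, $I=\{1,\ldots,p\}$, $J=\{p+1,\ldots,p+q\}$, and consider the problem $$\min\{\varphi_0(z)\mid \varphi_i(z)\le 0\ (i\in I),\ \varphi_i(z)=0\ (i\in J)\}.$$ Let $\bar z$ be a feasible point of this problem such that $\varphi_0,\ldots,\varphi_{p+q}$ are locally Lipschitz continuous in a neighborhood of $\bar z$, and assume that $\varphi_{p+1},\ldots,\varphi_{p+q}$ are continuously differentiable in a neighborhood of $\bar z$. Let $\partial^\square$ be either the limiting subdifferential $\partial$ or the Clarke subdifferential $\partial^{\mathrm c}$. If $\partial^\square$-RCPLD holds at $\bar z$, then $\bar z$ is asymptotically $\partial^\square$-regular (A$\partial^\square$-regular).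
   Context: $\overline{\mathbb{R}}=\mathbb{R}\cup\{-\infty,\infty\}$. For a closed set $A\subset\mathbb{R}^n$ and $\bar z\in A$, the regular normal cone is $\widehat{\mathcal N}_A(\bar z)=\{\xi\mid \forall z\in A:\ \xi^\top(z-\bar z)\le o(\|z-\bar z\|)\}$ and the limiting normal cone is $\mathcal N_A(\bar z)=\limsup_{z\to\bar z,\,z\in A}\widehat{\mathcal N}_A(z)$. For a function $\psi$ that is locally Lipschitz continuous at $\bar z$, the limiting (Mordukhovich) subdifferential is $\partial\psi(\bar z)=\{\xi\mid(\xi,-1)\in\mathcal N_{\operatorname{epi}\psi}(\bar z,\psi(\bar z))\}$ and the Clarke subdifferential is $\partial^{\mathrm c}\psi(\bar z)=\operatorname{conv}\partial\psi(\bar z)$. Subdifferentials are only considered at points near which the function is Lipschitz continuous. The outer limit of a set-valued map $\Gamma$ at $\bar z$ is $\limsup_{z\to\bar z}\Gamma(z)=\{\xi\mid\exists z^k\to\bar z,\ \xi^k\to\xi,\ \xi^k\in\Gamma(z^k)\ \forall k\}$ (restricted to $z^k\in A$ when written $z\to\bar z$, $z\in A$). For a fixed feasible point $\bar z$ let $I(\bar z)=\{i\in I\mid\varphi_i(\bar z)=0\}$ and define, for $z\in\mathbb{R}^n$ (near $\bar z$), $$\overline{\mathcal M}^{\square}(z)=\bigcup_{\lambda_i\ge0\,(i\in I(\bar z)\cup J)}\Bigl[\sum_{i\in I(\bar z)}\lambda_i\,\partial^\square\varphi_i(z)+\sum_{i\in J}\lambda_i\bigl(\partial^\square\varphi_i(z)\cup\partial^\square(-\varphi_i)(z)\bigr)\Bigr].$$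 The point $\bar z$ is A$\partial^\square$-regular if $\limsup_{z\to\bar z}\overline{\mathcal M}^\square(z)\subset\overline{\mathcal M}^\square(\bar z)$. A pair of finite families $((a_i)_{i\in I_1},(b_i)_{i\in I_2})$ in $\mathbb{R}^n$ is positive linearly dependent if there are scalars $\alpha_i\ge0$ ($i\in I_1$) and $\beta_i\in\mathbb{R}$ ($i\in I_2$), not all zero, with $\sum_{i\in I_1}\alpha_ia_i+\sum_{i\in I_2}\beta_ib_i=0$. $\partial^\square$-RCPLD (relaxed constant positive linear dependence constraint qualification w.r.t. $\partial^\square$) holds at $\bar z$ if: (i) the family $(\nabla\varphi_i(z))_{i\in J}$ has constant rank in some neighborhood of $\bar z$; (ii) there is an index set $\widetilde J\subset J$ such that $(\nabla\varphi_i(\bar z))_{i\in\widetilde J}$ is a basis of $\operatorname{span}\{\nabla\varphi_i(\bar z)\mid i\in J\}$; (iii) (with $\widetilde J$ from (ii)) for each index set $\widetilde I\subset I(\bar z)$ and each family $(\xi_i)_{i\in\widetilde I}$ with $\xi_i\in\partial^\square\varphi_i(\bar z)$ ($i\in\widetilde I$) such that the pair $((\xi_i)_{i\in\widetilde I},(\nabla\varphi_i(\bar z))_{i\in\widetilde J})$ is positive linearly dependent, and for arbitrary sequences $z^k\to\bar z$ and $\xi_i^k\to\xi_i$ with $\xi_i^k\in\partial^\square\varphi_i(z^k)$ for all $k\in\mathbb{N}$ and $i\in\widetilde I$, the vectors of the family $(\xi_i^k)_{i\in\widetilde I}\cup(\nabla\varphi_i(z^k))_{i\in\widetilde J}$ are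 linearly dependent for all sufficiently large $k\in\mathbb{N}$. *)

(* Defs.v *)
From HB Require Import structures.
From mathcomp Require Import all_boot all_order all_algebra.
From mathcomp Require Import all_classical all_reals all_analysis.
Import numFieldNormedType.Exports.

Set Implicit Arguments.
Unset Strict Implicit.
Unset Printing Implicit Defensive.

Local Open Scope classical_set_scope.
Local Open Scope ring_scope.

(* R^n is 'rV[R]_n, whose library norm is the
   maximum norm; the norm occurs only in notions (convergence, little-o,
   Lipschitz continuity) that do not depend on the choice of a norm on R^n. *)

Section VariationalAnalysis.
Context {R : realType}.

Definition dotv (n : nat) (x y : 'rV[R]_n) : R := (x *m y^T) 0 0.

Definition outer_limit (n m : nat) (G : 'rV[R]_n -> set 'rV[R]_m)
    (A : set 'rV[R]_n) (zbar : 'rV[R]_n) : set 'rV[R]_m :=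
  [set xi | exists (zs : nat -> 'rV[R]_n) (xis : nat -> 'rV[R]_m),
    [/\ zs @ \oo --> zbar, xis @ \oo --> xi &
        forall k, A (zs k) /\ G (zs k) (xis k)]].

Definition regular_normal_cone (n : nat) (A : set 'rV[R]_n)
    (zbar : 'rV[R]_n) : set 'rV[R]_n :=
  [set xi | forall e : R, 0 < e ->
    \forall z \near zbar, A z -> dotv xi (z - zbar) <= e * `|z - zbar|].

Definition limiting_normal_cone (n : nat) (A : set 'rV[R]_n)
    (zbar : 'rV[R]_n) : set 'rV[R]_n :=
  outer_limit (regular_normal_cone A) A zbar.

(* R^n x R is represented by 'rV[R]_(n + 1), with (x, t) written pairv x t. *)
Definition pairv (n : nat) (x : 'rV[R]_n) (t : R) : 'rV[R]_(n + 1) :=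
  row_mx x (const_mx t).

Definition epi (n : nat) (psi : 'rV[R]_n -> \bar R) : set 'rV[R]_(n + 1) :=
  [set w | (psi (lsubmx w) <= (rsubmx w 0 0)%:E)%E].

(* The subdifferentials are total; they are empty where psi is infinite, and
   meant to be used only at points near which psi is Lipschitz continuous. *)
Definition limiting_subdiff (n : nat) (psi : 'rV[R]_n -> \bar R)
    (zbar : 'rV[R]_n) : set 'rV[R]_n :=
  [set xi | psi zbar \is a fin_num /\
    limiting_normal_cone (epi psi) (pairv zbar (fine (psi zbar)))
      (pairv xi (-1))].

Definition conv_hull (n : nat) (A : set 'rV[R]_n) : set 'rV[R]_n :=
  smallest (@convex_set R 'rV[R]_n) A.

Definition clarke_subdiff (n : nat) (psi : 'rV[R]_n -> \bar R)
    (zbar : 'rV[R]_n) : set 'rV[R]_n :=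
  conv_hull (limiting_subdiff psi zbar).

Definition lipschitz_near (n : nat) (psi : 'rV[R]_n -> \bar R)
    (z : 'rV[R]_n) : Prop :=
  exists U : set 'rV[R]_n,
    [/\ nbhs z U, forall x, U x -> psi x \is a fin_num &
        [lipschitz (fine (psi x) : R^o) | x in U]].

Definition grad (n : nat) (psi : 'rV[R]_n -> \bar R) (z : 'rV[R]_n) :
    'rV[R]_n :=
  \row_j 'D_(delta_mx 0 j) (fun x => fine (psi x) : R^o) z.

Definition cont_differentiable_near (n : nat) (psi : 'rV[R]_n -> \bar R)
    (zbar : 'rV[R]_n) : Prop :=
  \forall z \near zbar,
    [/\ psi z \is a fin_num,
        differentiable (fun x => fine (psi x) : R^o) z &
        {for z, continuous (grad psi)}].

Definition pos_lin_dep (n : nat) (K : finType) (I1 I2 : {set K})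
    (a b : K -> 'rV[R]_n) : Prop :=
  exists alpha beta : K -> R,
    [/\ forall i, i \in I1 -> 0 <= alpha i,
        (exists2 i, i \in I1 & alpha i != 0) \/
        (exists2 i, i \in I2 & beta i != 0) &
        \sum_(i in I1) alpha i *: a i + \sum_(i in I2) beta i *: b i = 0].

End VariationalAnalysis.

Inductive subdiff_kind := Limiting | Clarke.

Definition subdiff (R : realType) (box : subdiff_kind) (n : nat) :
    ('rV[R]_n -> \bar R) -> 'rV[R]_n -> set 'rV[R]_n :=
  match box with
  | Limiting => @limiting_subdiff R n
  | Clarke => @clarke_subdiff R n
  end.

(* The functions phi_0, ..., phi_{p+q} are indexed by 'I_(p + q).+1. *)
Definition ineq_idx (p q : nat) : {set 'I_(p + q).+1} :=
  [set i : 'I_(p + q).+1 | (1 <= i <= p)%N]%SET.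

Definition eq_idx (p q : nat) : {set 'I_(p + q).+1} :=
  [set i : 'I_(p + q).+1 | (p.+1 <= i <= p + q)%N]%SET.

Section Program.
Context {R : realType} {n p q : nat}.
Variable phi : 'I_(p + q).+1 -> 'rV[R]_n -> \bar R.

Local Notation I := (ineq_idx p q).
Local Notation J := (eq_idx p q).

Definition feasible (z : 'rV[R]_n) : Prop :=
  (forall i, i \in I -> (phi i z <= 0)%E) /\
  (forall i, i \in J -> phi i z = 0%E).

Definition active (zbar : 'rV[R]_n) : {set 'I_(p + q).+1} :=
  [set i in I | phi i zbar == 0%E]%SET.

(* zbar only determines the active indices; the subdifferentials are taken
   at z. *)
Definition Mbar (box : subdiff_kind) (zbar z : 'rV[R]_n) : set 'rV[R]_n :=
  [set w | exists (lambda : 'I_(p + q).+1 -> R)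
                  (xi : 'I_(p + q).+1 -> 'rV[R]_n),
    [/\ forall i, i \in active zbar :|: J -> 0 <= lambda i,
        forall i, i \in active zbar -> subdiff box (phi i) z (xi i),
        forall i, i \in J ->
          (subdiff box (phi i) z `|` subdiff box (fun x => - phi i x)%E z)
            (xi i) &
        w = \sum_(i in active zbar) lambda i *: xi i +
            \sum_(i in J) lambda i *: xi i]].

Definition asymptotically_regular (box : subdiff_kind) (zbar : 'rV[R]_n) :
    Prop :=
  outer_limit (Mbar box zbar) setT zbar `<=` Mbar box zbar zbar.

Definition RCPLD (box : subdiff_kind) (zbar : 'rV[R]_n) : Prop :=
  (exists r : nat, \forall z \near zbar,
     \dim <<[seq grad (phi i) z | i in J]>>%VS = r) /\
  (exists Jt : {set 'I_(p + q).+1},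
    [/\ Jt \subset J,
        basis_of <<[seq grad (phi i) zbar | i in J]>>%VS
          [seq grad (phi i) zbar | i in Jt] &
        forall (It : {set 'I_(p + q).+1}) (xi : 'I_(p + q).+1 -> 'rV[R]_n),
          It \subset active zbar ->
          (forall i, i \in It -> subdiff box (phi i) zbar (xi i)) ->
          pos_lin_dep It Jt xi (fun i => grad (phi i) zbar) ->
          forall (zs : nat -> 'rV[R]_n)
                 (xis : nat -> 'I_(p + q).+1 -> 'rV[R]_n),
            zs @ \oo --> zbar ->
            (forall i, i \in It -> (fun k => xis k i) @ \oo --> xi i) ->
            (forall k i, i \in It -> subdiff box (phi i) (zs k) (xis k i)) ->
            \forall k \near \oo,
              ~~ free ([seq xis k i | i in It] ++
                       [seq grad (phi i) (zs k) | i in Jt])]).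

End Program.

(* Main.v *)
Require Import Defs.
From mathcomp Require Import all_boot all_order all_algebra.
From mathcomp Require Import all_classical all_reals all_analysis.
From mathcomp Require Import ring lra.
Import Order.TTheory GRing.Theory Num.Theory.
Import numFieldNormedType.Exports.

(** Let [w] be the limit of multiplier combinations
    [ws k] at points [zs k] tending to [zbar]. Near [zbar] the equality
    constraints have a single subgradient, the gradient
    ([cont_differentiable_subdiff]), and by constant rank the gradients indexed by
    [Jt] stay a basis of the span of all of them ([lin_indep_near],
    [span_full_rank]). Hence the equality part of [ws k] is a sign-free
    combination of these basis gradients, and a Caratheodory reduction that leaves
    them alone discards active inequality constraints until the remaining
    generators are linearly independent ([conic_caratheodory],
    [Mbar_independent]).

    Passing to a subsequence, the set [T] of remaining inequality constraints is
    constant and the subgradients converge, since subdifferentials of Lipschitz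
    functions are locally bounded ([subdiff_bounded]); the limits are subgradients
    at [zbar] because the subdifferentials have closed graph ([subdiff_closed]).
    Now there are two cases ([coef_limit]). If the coefficients stay bounded,
    they converge along a subsequence and display [w] as a multiplier combination
    at [zbar] ([Mbar_of_generators]). If not, dividing by their size shows that the
    limit generators are positively linearly dependent, and then the constraint
    qualification makes the generators at [zs k] linearly dependent for large [k],
    contrary to their choice.

    For the limiting subdifferential, boundedness and the gradient formula come
    from testing regular normals of the epigraph against suitable points
    ([epi_normal_test]), closedness from a diagonal sequence. The Clarke
    subdifferential inherits all three; closedness is the delicate one and rests
    on the Caratheodory theorem ([conv_hull_limit]). *)

Set Implicit Arguments.
Unset Strict Implicit.
Unset Printing Implicit Defensive.

Local Open Scope classical_set_scope.
Local Open Scope ring_scope.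

(** * Subsequences and limits *)

Lemma ex_choice (X Y : Type) (P : X -> Y -> Prop) :
  (forall x, exists y, P x y) -> exists f : X -> Y, forall x, P x (f x).
Proof. by case/choice => f Pf; exists f. Qed.

(** A subsequence is given by any index map [f] with [j <= f j]. Monotonicity is
    not imposed: the inequality alone preserves limits and is stable under
    composition, which makes successive extractions cheap. *)
Lemma subseq_infty (f : nat -> nat) :
  (forall j, (j <= f j)%N) -> f @ \oo --> \oo.
Proof.
move=> fge A [N _ NA]; exists N => // j /= Nj.
by apply: NA; exact: leq_trans Nj (fge j).
Qed.

Lemma subseq_cvg (T : topologicalType) (f : nat -> nat) (u : nat -> T) (l : T) :
  (forall j, (j <= f j)%N) -> u @ \oo --> l -> u (f j) @[j --> \oo] --> l.
Proof. by move=> /subseq_infty fo ul; exact: (cvg_comp f u fo ul). Qed.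

Lemma frequently_subseq (P : nat -> Prop) :
  (forall N, exists2 k, (N <= k)%N & P k) ->
  exists f : nat -> nat, forall j, (j <= f j)%N /\ P (f j).
Proof.
move=> freq.
by apply: (@ex_choice _ _ (fun N k => (N <= k)%N /\ P k)) => N; case: (freq N) => k; exists k.
Qed.

Lemma not_near_infty (P : nat -> Prop) :
  ~ (\forall k \near \oo, P k) -> forall N, exists2 k, (N <= k)%N & ~ P k.
Proof.
move=> nP N; apply: contrapT => nex; apply: nP; exists N => // k /= Nk.
by apply: contrapT => nPk; apply: nex; exists k.
Qed.

(** Pigeonhole: otherwise every value is left for good after some index, and
    the value taken at the largest of these indices contradicts this. *)
Lemma finType_subseq (F : finType) (c : nat -> F) :
  exists x (f : nat -> nat), forall j, (j <= f j)%N /\ c (f j) = x.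
Proof.
suff [x freq] : exists x, forall N, exists2 k, (N <= k)%N & c k = x.
  by exists x; exact: (frequently_subseq freq).
apply: contrapT => /forallNP nfreq.
have [N HN] : exists N : F -> nat, forall x k, (N x <= k)%N -> c k <> x.
  apply: (@ex_choice _ _ (fun x N => forall k, (N <= k)%N -> c k <> x)) => x.
  have /existsNP[N HN] := nfreq x; exists N => k Nk ckx.
  by apply: HN; exists k.
apply: (HN (c (\max_x N x)) (\max_x N x)%N) => //.
exact: (@leq_bigmax _ N).
Qed.

Section RealVectors.
Context {R : realType}.

Lemma mx_entry_le m n (x : 'M[R]_(m, n)) i j : `|x i j| <= `|x|.
Proof.
by rewrite [leRHS]/Num.norm /= mx_normrE; apply/bigmax_geP; right; exists (i, j).
Qed.

Lemma mx_norm_leP m n (x : 'M[R]_(m, n)) (e : R) : 0 <= e ->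
  (forall i j, `|x i j| <= e) -> `|x| <= e.
Proof.
move=> e0 xe; rewrite [leLHS]/Num.norm /= mx_normrE.
by apply/bigmax_leP; split => // -[i j] _; exact: xe.
Qed.

Lemma cvg_mx m n (u : nat -> 'M[R]_(m, n)) (l : 'M[R]_(m, n)) :
  (forall i j, u k i j @[k --> \oo] --> l i j) -> u @ \oo --> l.
Proof.
move=> ul; apply/cvgrPdist_le => e e0.
have : \forall k \near \oo, forall ij : 'I_m * 'I_n,
    `|l ij.1 ij.2 - u k ij.1 ij.2| <= e.
  apply: filter_forall => -[i j] /=.
  by move/cvgrPdist_le : (ul i j); apply.
apply: filterS => k uk; apply: mx_norm_leP; first exact: ltW.
by move=> i j; rewrite !mxE; exact: (uk (i, j)).
Qed.

Lemma cvg_entry m n (u : nat -> 'M[R]_(m, n)) (l : 'M[R]_(m, n)) i j :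
  u @ \oo --> l -> u k i j @[k --> \oo] --> l i j.
Proof.
move=> ul.
exact: (cvg_comp u (fun M : 'M[R]_(m, n) => M i j) ul (@coord_continuous _ m n i j l)).
Qed.

Lemma cvg_big_sum (V : normedModType R) (K : finType) (P : pred K)
    (u : nat -> K -> V) (l : K -> V) :
  (forall i, P i -> u k i @[k --> \oo] --> l i) ->
  \sum_(i | P i) u k i @[k --> \oo] --> \sum_(i | P i) l i.
Proof.
move=> ul; elim: (index_enum K) => [|i s IHs].
  rewrite big_nil; under eq_cvg do rewrite big_nil; exact: cvg_cst.
rewrite big_cons; under eq_cvg do rewrite big_cons.
by case: (boolP (P i)) => [Pi|//]; apply: cvgD IHs; exact: ul.
Qed.

Lemma bounded_subseq (u : nat -> R) (M : R) :
  (forall k, `|u k| <= M) ->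
  exists2 f : nat -> nat, (forall j, (j <= f j)%N) & cvgn (u \o f).
Proof.
move=> uM; have [|f fincr ucvg] := @bolzano_weierstrass R u.
  exists M; split; first exact: num_real.
  by move=> x Mx k _ /=; exact: le_trans (uM k) (ltW Mx).
exists f => //; elim=> [//|j IHj]; apply: leq_ltn_trans IHj _.
by have := fincr j.+1 j; rewrite leEnat [RHS]ltnn ltnNge => ->.
Qed.

Lemma bounded_subseq_seq (K : eqType) (s : seq K) (u : nat -> K -> R) :
  (forall i, i \in s -> exists M, forall k, `|u k i| <= M) ->
  exists2 f : nat -> nat, (forall j, (j <= f j)%N) &
    exists l : K -> R, forall i, i \in s -> u (f j) i @[j --> \oo] --> l i.
Proof.
elim: s => [|a s IHs] ub.
  by exists id => //; exists (fun=> 0).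
have [|f fge [l fl]] := IHs; first by move=> i si; apply: ub; rewrite in_cons si orbT.
have [M uM] := ub a (mem_head _ _).
have [|g gge /cvg_ex[la gl]] := @bounded_subseq (fun j => u (f j) a) M.
  by move=> k; exact: uM.
exists (f \o g) => [j|]; first exact: leq_trans (gge j) (fge _).
exists (fun i => if i == a then la else l i) => i.
case: eqVneq => [-> _ //|ia]; rewrite in_cons (negbTE ia) /= => si.
by apply: (@subseq_cvg _ g (fun j => u (f j) i)) => //; exact: fl.
Qed.

(** Bolzano-Weierstrass for finitely many sequences at once, by successive
    extractions over all scalar coordinates. *)
Lemma bounded_subseq_fam (K : finType) (S : {set K}) n
    (v : nat -> K -> 'rV[R]_n) :
  (forall i, i \in S -> exists M, \forall k \near \oo, `|v k i| <= M) ->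
  exists2 f : nat -> nat, (forall j, (j <= f j)%N) &
    exists l : K -> 'rV[R]_n, forall i, i \in S -> v (f j) i @[j --> \oo] --> l i.
Proof.
move=> vb.
have [M vM] : exists M : K -> R, forall i, i \in S ->
    \forall k \near \oo, `|v k i| <= M i.
  apply: (@ex_choice _ _ (fun i M => i \in S -> \forall k \near \oo, `|v k i| <= M)) => i.
  by case: (boolP (i \in S)) => [/vb[M vM]|_]; [exists M|exists 0].
have : \forall k \near \oo, forall i, i \in S -> `|v k i| <= M i.
  apply: filter_forall => i; case: (boolP (i \in S)) => [iS|_].
    by apply: filterS (vM i iS) => k + _.
  by apply: nearW.
case=> N _ NM.
have [|f fge [l fl]] := @bounded_subseq_seq (K * 'I_n)%type
  (enum [set ij : K * 'I_n | ij.1 \in S]) (fun k ij => v (k + N)%N ij.1 0 ij.2).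
  case=> i j; rewrite mem_enum inE /= => iS; exists (M i) => k.
  by apply: le_trans (mx_entry_le _ _ _) _; apply: NM => //=; exact: leq_addl.
exists (fun j => f j + N)%N => [j|]; first exact: leq_trans (fge j) (leq_addr _ _).
exists (fun i => \row_j l (i, j)) => i iS; apply: cvg_mx => a b.
by rewrite mxE (ord1 a); apply: (fl (i, b)); rewrite mem_enum inE.
Qed.

End RealVectors.

Lemma cvg_ge0 (R : realType) (u : nat -> R) (l : R) :
  u @ \oo --> l -> (\forall k \near \oo, 0 <= u k) -> 0 <= l.
Proof.
move=> ul u0; rewrite -(cvg_lim (@norm_hausdorff _ _) ul).
by apply: limr_ge => //; exact: cvgP ul.
Qed.

(** * Linear independence and conic Caratheodory reduction *)

(** Independence of a family indexed by [S], by coefficients: unlike freeness of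
    a list, it refers to no enumeration of [S] and combines directly with sums over
    index sets. *)
Definition lin_indep (R : fieldType) (V : lmodType R) (K : finType)
    (S : {set K}) (v : K -> V) : Prop :=
  forall c : K -> R, \sum_(i in S) c i *: v i = 0 -> forall i, i \in S -> c i = 0.

Lemma sum_setU (V : nmodType) (K : finType) (A B : {set K}) (F : K -> V) :
  {in A, forall i, i \notin B} ->
  \sum_(i in A :|: B) F i = \sum_(i in A) F i + \sum_(i in B) F i.
Proof.
move=> dAB; rewrite (big_setID A) /= (finset.setIidPr (finset.subsetUl A B)).
congr (_ + _); apply: eq_bigl => i; rewrite !inE.
by case: (boolP (i \in A)) => //= /dAB/negbTE.
Qed.

Lemma sum_supset (V : nmodType) (K : finType) (S T : {set K}) (F : K -> V) :
  T \subset S -> (forall i, i \in S -> i \notin T -> F i = 0) ->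
  \sum_(i in S) F i = \sum_(i in T) F i.
Proof.
move=> TS F0; rewrite (big_setID T) /= (finset.setIidPr TS).
by rewrite [X in _ + X]big1 ?addr0 // => i; rewrite inE => /andP[iT iS]; exact: F0.
Qed.

Section LinearIndependence.
Variables (R : fieldType) (V : vectType R) (K : finType).
Implicit Types (S T : {set K}) (v : K -> V) (s : seq K).

Lemma free_seqP s v : uniq s ->
  free [seq v i | i <- s] <->
  (forall c : K -> R, \sum_(i <- s) c i *: v i = 0 -> forall i, i \in s -> c i = 0).
Proof.
have nthE (c : K -> R) (i0 : K) :
    \sum_(i <- s) c i *: v i =
    \sum_(j < size [seq v i | i <- s]) c (nth i0 s j) *: [seq v i | i <- s]`_j.
  rewrite (big_nth i0) big_mkord size_map.
  by apply: eq_bigr => j _ /=; rewrite (nth_map i0).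
move=> us; split.
  move=> /(@freeP _ _ _ (in_tuple _)) fr c sc0 i si.
  have ilt : (index i s < size [seq v i | i <- s])%N by rewrite size_map index_mem.
  have := fr (fun j => c (nth i s j)) _ (Ordinal ilt).
  by rewrite /= nth_index //; apply; rewrite -[RHS]sc0 (nthE _ i).
move=> ind; apply/(@freeP _ _ _ (in_tuple _)) => c sc0 j.
have jlt : (j < size s)%N by rewrite -(size_map v).
have [i0 _] : exists i0 : K, true by move: (j : nat) jlt => k; case: (s) => // i0; exists i0.
pose c' i := c (insubd j (index i s)).
have c'E (k : 'I_(size (map v s))) : c' (nth i0 s k) = c k.
  have klt : (k < size s)%N by rewrite -(size_map v).
  by rewrite /c' index_uniq // valKd.
rewrite -(c'E j); apply: ind; last exact: mem_nth.
by rewrite -[RHS]sc0 (nthE _ i0); apply: eq_bigr => k _; rewrite c'E.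
Qed.

Lemma free_imageP S v : free [seq v i | i in S] <-> lin_indep S v.
Proof.
rewrite /image_mem free_seqP ?enum_uniq //; split=> ind c sc0 i iS; apply: (ind c).
- by rewrite big_enum.
- by rewrite mem_enum.
- by rewrite -big_enum.
- by rewrite -mem_enum.
Qed.

Lemma eq_lin_indep S v w : {in S, v =1 w} -> lin_indep S v -> lin_indep S w.
Proof.
move=> vw ind c sc0; apply: ind; rewrite -[RHS]sc0.
by apply: eq_bigr => i iS; rewrite vw.
Qed.

(** Two concatenated families with disjoint index sets are one family, so that
    freeness of the list becomes independence over the union. *)
Lemma free_cat_imageP (A B : {set K}) (a b : K -> V) : {in A, forall i, i \notin B} ->
  free ([seq a i | i in A] ++ [seq b i | i in B]) <->
  lin_indep (A :|: B) (fun i => if i \in A then a i else b i).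
Proof.
move=> dAB; set w := fun i => if i \in A then a i else b i.
have BA i : i \in B -> (i \in A) = false.
  by move=> iB; apply/negP => /dAB; rewrite iB.
rewrite -free_imageP.
have -> : [seq a i | i in A] ++ [seq b i | i in B] = [seq w i | i <- enum A ++ enum B].
  rewrite map_cat; congr (_ ++ _); apply/eq_in_map => i; rewrite mem_enum /w => iX.
    by rewrite iX.
  by rewrite BA.
suff p : perm_eq (enum A ++ enum B) (enum (A :|: B)) by rewrite (perm_free (perm_map w p)).
apply: uniq_perm.
- rewrite cat_uniq !enum_uniq /= andbT; apply/hasPn => i; rewrite !mem_enum.
  by move=> iB; rewrite /= BA.
- exact: enum_uniq.
- by move=> i; rewrite mem_cat !mem_enum inE.
Qed.

Lemma span_imageP S v x : x \in <<[seq v i | i in S]>>%VS ->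
  exists c : K -> R, x = \sum_(i in S) c i *: v i.
Proof.
rewrite span_def big_map big_enum /= => /memv_sumP[w wP ->].
have /ex_choice[c cP] : forall i, exists k, i \in S -> w i = k *: v i.
  move=> i; case: (boolP (i \in S)) => [iS|_]; last by exists 0.
  by have /vlineP[k ->] := wP i iS; exists k.
by exists c; apply: eq_bigr => i iS; rewrite cP.
Qed.

Lemma lin_indep_card S v : lin_indep S v -> (#|S| <= \dim {:V})%N.
Proof.
move=> /free_imageP; rewrite /free size_map -cardE => /eqP <-.
exact/dimvS/subvf.
Qed.

(** An independent subfamily with as many members as the dimension of the span
    of the whole family spans the same space. *)
Lemma span_full_rank S T v : T \subset S -> lin_indep T v ->
  (\dim <<[seq v i | i in S]>>%VS <= #|T|)%N ->
  forall i, i \in S -> exists c : K -> R, v i = \sum_(j in T) c j *: v j.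
Proof.
move=> TS /free_imageP indT dS i iS; apply: span_imageP.
have /eqP -> : <<[seq v j | j in T]>>%VS == <<[seq v j | j in S]>>%VS.
  rewrite eqEdim; apply/andP; split.
    apply: sub_span => x /mapP[j]; rewrite mem_enum => jT ->.
    by apply/map_f; rewrite mem_enum (fintype.subsetP TS).
  by move: indT; rewrite /free size_map -cardE => /eqP ->.
by apply/memv_span/map_f; rewrite mem_enum.
Qed.

End LinearIndependence.

(** Caratheodory reduction with a protected independent block [J] whose
    coefficients are free in sign. As long as the family over [I :|: J] is
    dependent, a multiple of a dependency can be subtracted so that one
    coefficient over [I] vanishes and the others over [I] stay nonnegative; the
    index is dropped, so the process ends. The block [J] is never touched because
    a dependency cannot live on [J] alone. *)
Lemma conic_caratheodory (R : realFieldType) (V : vectType R) (K : finType)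
    (I J : {set K}) (v : K -> V) (c : K -> R) :
  {in I, forall i, i \notin J} -> lin_indep J v -> (forall i, i \in I -> 0 <= c i) ->
  exists (T : {set K}) (d : K -> R),
    [/\ T \subset I, forall i, i \in T -> 0 <= d i, lin_indep (T :|: J) v &
        \sum_(i in I :|: J) c i *: v i = \sum_(i in T :|: J) d i *: v i].
Proof.
move=> + indJ.
have [m] := ubnP #|I|; elim: m I c => // m IHm I c; rewrite ltnS => Im dIJ c0.
have drop i d : i \in I -> (forall j, j \in I -> 0 <= d j) -> d i = 0 ->
    \sum_(i in I :|: J) c i *: v i = \sum_(i in I :|: J) d i *: v i ->
  exists (T : {set K}) (d : K -> R),
    [/\ T \subset I, forall i, i \in T -> 0 <= d i, lin_indep (T :|: J) v &
        \sum_(i in I :|: J) c i *: v i = \sum_(i in T :|: J) d i *: v i].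
  move=> iI d0 di0 ->.
  have [|||T [e [TI e0 indT de]]] := IHm (I :\ i) d.
  - by move: Im; rewrite (cardsD1 i I) iI add1n.
  - by move=> j /setD1P[_ jI]; exact: dIJ.
  - by move=> j /setD1P[_ jI]; exact: d0.
  exists T, e; split => //; first by apply: fintype.subset_trans TI (finset.subsetDl _ _).
  rewrite -de (bigD1 i) ?inE ?iI //= di0 scale0r add0r; apply: eq_bigl => j.
  rewrite !inE; case: eqVneq => [->|_]; last by rewrite andbT.
  by rewrite /= andbF (negbTE (dIJ _ iI)).
have [indI|/existsNP[d /not_implyP[sd0 /existsNP[i0 /not_implyP[i0IJ /eqP di0]]]]] :=
    pselect (lin_indep (I :|: J) v).
  by exists I, c.
have [e [se0 [i iI ei]]] : exists e : K -> R,
    \sum_(i in I :|: J) e i *: v i = 0 /\ exists2 i, i \in I & 0 < e i.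
  have [i iI di] : exists2 i, i \in I & d i != 0.
    apply: contrapT => nd; have dI i : i \in I -> d i = 0.
      by move=> iI; apply: contrapT => /eqP di; apply: nd; exists i.
    case/negP: di0; apply/eqP; case/setUP: i0IJ => [/dI//|]; move: i0.
    apply: indJ; rewrite -[RHS]sd0 [RHS](big_setID J) /= (finset.setIidPr (finset.subsetUr I J)).
    rewrite [X in _ = _ + X]big1 ?addr0 // => i.
    by rewrite !inE => /andP[/negbTE->]; rewrite orbF => /dI ->; rewrite scale0r.
  have [dip|din|d0] := ltgtP (d i) 0; last by rewrite d0 eqxx in di.
    exists (fun i => - d i); split; last by exists i => //; rewrite oppr_gt0.
    under eq_bigr do rewrite scaleNr.
    by rewrite sumrN sd0 oppr0.
  by exists d; split => //; exists i.
(* The smallest ratio is the largest multiple of [e] that can be subtracted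
   while keeping the coefficients over [I] nonnegative. *)
pose k := [arg min_(k < i | (k \in I) && (0 < e k)) (c k / e k)]%O.
have [kI ek kmin] : [/\ k \in I, 0 < e k &
    forall j, j \in I -> 0 < e j -> c k / e k <= c j / e j].
  rewrite /k; case: arg_minP => /=; first by rewrite iI.
  by move=> j /andP[jI ej] jmin; split => // l lI el; apply: jmin; rewrite lI.
apply: (drop k (fun j => c j - c k / e k * e j)) => //.
- move=> j jI; rewrite subr_ge0; have [ej|ej] := ltP 0 (e j).
    by rewrite -ler_pdivlMr //; exact: kmin.
  apply: le_trans (c0 _ jI); rewrite mulr_ge0_le0 // divr_ge0 ?c0 //; exact: ltW.
- by rewrite divfK ?subrr // gt_eqF.
- under [RHS]eq_bigr do rewrite scalerBl -scalerA.
  by rewrite sumrB -scaler_sumr se0 scaler0 subr0.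
Qed.

(** * Limits of linear combinations *)

Section Combinations.
Context {R : realType} {n : nat} {K : finType}.
Implicit Types (S : {set K}) (u : nat -> K -> 'rV[R]_n) (l : K -> 'rV[R]_n) (w : 'rV[R]_n).

Lemma cvg_lin_comb S u l (c : nat -> K -> R) (c' : K -> R) :
  (forall i, i \in S -> u k i @[k --> \oo] --> l i) ->
  (forall i, i \in S -> c k i @[k --> \oo] --> c' i) ->
  \sum_(i in S) c k i *: u k i @[k --> \oo] --> \sum_(i in S) c' i *: l i.
Proof.
move=> ul cc; apply: cvg_big_sum => i iS; apply: cvgZ; [exact: cc|exact: ul].
Qed.

(** Coefficients of total mass one are bounded and cannot all vanish in the
    limit, so a dependency between the limit vectors survives. *)
Lemma normalized_coef_limit S u l (c : nat -> K -> R) :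
  (forall i, i \in S -> u k i @[k --> \oo] --> l i) ->
  (forall k, \sum_(i in S) `|c k i| = 1) ->
  \sum_(i in S) c k i *: u k i @[k --> \oo] --> (0 : 'rV[R]_n) ->
  exists (f : nat -> nat) (c' : K -> R),
    [/\ forall j, (j <= f j)%N,
        forall i, i \in S -> c (f j) i @[j --> \oo] --> c' i,
        exists2 i, i \in S & c' i != 0 &
        \sum_(i in S) c' i *: l i = 0].
Proof.
move=> ul c1 cu0.
have [|f fge [c' cc']] := @bounded_subseq_seq R K (enum S) c.
  move=> i; rewrite mem_enum => iS; exists 1 => k; rewrite -(c1 k) (bigD1 i) //=.
  by rewrite lerDl sumr_ge0.
have {}cc' i : i \in S -> c (f j) i @[j --> \oo] --> c' i.
  by move=> iS; apply: cc'; rewrite mem_enum.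
exists f, c'; split => //.
- apply: contrapT => c'0.
  have : \sum_(i in S) `|c (f j) i| @[j --> \oo] --> \sum_(i in S) `|c' i|.
    by apply: (@cvg_big_sum R R^o) => i iS; apply: cvg_norm; exact: cc'.
  rewrite big1 => [|i iS]; last first.
    by apply/eqP; rewrite normr_eq0; apply: contrapT => /negP ci; apply: c'0; exists i.
  under eq_cvg do rewrite c1.
  by move=> /(norm_cvg_unique (cvg_cst (1 : R)))/eqP; rewrite oner_eq0.
- have h : \sum_(i in S) c (f j) i *: u (f j) i @[j --> \oo] -->
      \sum_(i in S) c' i *: l i.
    apply: (@cvg_lin_comb S (fun j => u (f j)) l (fun j => c (f j)) c') => // i iS.
    by apply: (@subseq_cvg _ f (fun k => u k i)) => //; exact: ul.
  apply: (norm_cvg_unique h).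
  exact: (@subseq_cvg _ f (fun k => \sum_(i in S) c k i *: u k i)).
Qed.

(** Independence is an open property: dependencies along a subsequence,
    normalised to total mass one, would yield a dependency of the limits. *)
Lemma lin_indep_near S u l :
  (forall i, i \in S -> u k i @[k --> \oo] --> l i) -> lin_indep S l ->
  \forall k \near \oo, lin_indep S (u k).
Proof.
move=> ul indl; apply: contrapT => /not_near_infty/frequently_subseq[f fP].
have /ex_choice[c cP] : forall j, exists c : K -> R,
    \sum_(i in S) c i *: u (f j) i = 0 /\ \sum_(i in S) `|c i| = 1.
  move=> j; have [_ /existsNP[c /not_implyP[c0 /existsNP[i /not_implyP[iS /eqP ci]]]]] := fP j.
  pose m := \sum_(i in S) `|c i|.
  have m0 : 0 < m.
    by rewrite /m (bigD1 i) //= ltr_wpDr ?normr_gt0 ?sumr_ge0.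
  exists (fun i => m^-1 * c i); split.
    under eq_bigr do rewrite -scalerA.
    by rewrite -scaler_sumr c0 scaler0.
  under eq_bigr do rewrite normrM gtr0_norm ?invr_gt0 //.
  by rewrite -mulr_sumr mulVf // gt_eqF.
have [|||g [c' [_ _ [i iS ci] c'0]]] :=
    @normalized_coef_limit S (fun j => u (f j)) l c.
- move=> i iS; apply: (@subseq_cvg _ f (fun k => u k i)) => [j|]; last exact: ul.
  by case: (fP j).
- by move=> k; case: (cP k).
- have E j : \sum_(i in S) c j i *: u (f j) i = 0 by case: (cP j).
  under eq_cvg do rewrite E.
  exact: cvg_cst.
- by move/eqP: ci; apply; exact: indl c'0 i iS.
Qed.

(** The dichotomy behind the theorem. Along a subsequence, either the
    coefficients stay bounded and the representation passes to the limit (with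
    scaling [t] equal to one), or their mass [m] blows up and dividing by it
    gives a nontrivial dependency between the limit vectors. The scaling is
    nonnegative, so signs of coefficients are kept in both cases. *)
Lemma coef_limit S u l (c : nat -> K -> R) w :
  (forall i, i \in S -> u k i @[k --> \oo] --> l i) ->
  \sum_(i in S) c k i *: u k i @[k --> \oo] --> w ->
  exists (f : nat -> nat) (t : nat -> R) (c' : K -> R),
    [/\ forall j, (j <= f j)%N, forall j, 0 <= t j,
        forall i, i \in S -> t j * c (f j) i @[j --> \oo] --> c' i &
        \sum_(i in S) c' i *: l i = w \/
        (exists2 i, i \in S & c' i != 0) /\ \sum_(i in S) c' i *: l i = 0].
Proof.
move=> ul cw; pose m k : R := \sum_(i in S) `|c k i|.
have [[M Mfreq]|Mfreq] := pselect (exists M : R, forall N, exists2 k, (N <= k)%N & m k <= M).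
  have [f fP] := frequently_subseq Mfreq.
  have fge j : (j <= f j)%N by case: (fP j).
  have [|g gge [c' cc']] := @bounded_subseq_seq R K (enum S) (fun j => c (f j)).
    move=> i; rewrite mem_enum => iS; exists M => k; case: (fP k) => _.
    by apply: le_trans; rewrite /m (bigD1 i) //= lerDl sumr_ge0.
  have fgge j : (j <= f (g j))%N by exact: leq_trans (gge j) (fge _).
  have {}cc' i : i \in S -> c (f (g j)) i @[j --> \oo] --> c' i.
    by move=> iS; apply: cc'; rewrite mem_enum.
  exists (f \o g), (fun=> 1), c'; split => //.
    by move=> i iS; under eq_cvg do rewrite mul1r; exact: cc'.
  left.
  have h : \sum_(i in S) c (f (g j)) i *: u (f (g j)) i @[j --> \oo] -->
      \sum_(i in S) c' i *: l i.
    apply: (@cvg_lin_comb S (fun j => u (f (g j))) l (fun j => c (f (g j))) c') => // i iS.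
    by apply: (@subseq_cvg _ (f \o g) (fun k => u k i)) => //; exact: ul.
  apply: (norm_cvg_unique h).
  exact: (@subseq_cvg _ (f \o g) (fun k => \sum_(i in S) c k i *: u k i)).
have minf (M : R) : \forall k \near \oo, M < m k.
  apply: contrapT => /not_near_infty h; apply: Mfreq; exists M => N.
  by have [k Nk /negP] := h N; rewrite -leNgt => mM; exists k.
have [N _ mN] := minf 1.
have m0 k : 0 < m (k + N)%N by apply: lt_trans (mN _ _) => //=; exact: leq_addl.
have addge k : (k <= k + N)%N by exact: leq_addr.
have [|||f [c' [fge cc' ci c'0]]] :=
    @normalized_coef_limit S (fun k => u (k + N)%N) l
      (fun k i => (m (k + N)%N)^-1 * c (k + N)%N i).
- by move=> i iS; apply: (@subseq_cvg _ (addn^~ N) (fun k => u k i)) => //; exact: ul.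
- move=> k; under eq_bigr do rewrite normrM gtr0_norm ?invr_gt0 //.
  by rewrite -mulr_sumr mulVf // gt_eqF.
- have E k : \sum_(i in S) ((m (k + N)%N)^-1 * c (k + N)%N i) *: u (k + N)%N i =
      (m (k + N)%N)^-1 *: \sum_(i in S) c (k + N)%N i *: u (k + N)%N i.
    by rewrite scaler_sumr; apply: eq_bigr => i _; rewrite scalerA.
  under eq_cvg do rewrite E.
  suff : (m (k + N)%N)^-1 *: \sum_(i in S) c (k + N)%N i *: u (k + N)%N i
      @[k --> \oo] --> 0 *: w by rewrite scale0r.
  apply: cvgZ; last first.
    exact: (@subseq_cvg _ (addn^~ N) (fun k => \sum_(i in S) c k i *: u k i)).
  apply: (@subseq_cvg _ (addn^~ N) (fun k => (m k)^-1)) => //.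
  apply/cvgrPdist_lt => e e0; near=> k.
  have mk : e^-1 < m k by near: k; exact: minf.
  have mk0 : 0 < m k by apply: lt_trans mk; rewrite invr_gt0.
  rewrite sub0r normrN gtr0_norm ?invr_gt0 //.
  by rewrite invf_plt // posrE.
exists (fun j => f j + N)%N, (fun j => (m (f j + N)%N)^-1), c'; split => //.
- by move=> j; exact: leq_trans (fge j) (addge _).
- by move=> j; rewrite invr_ge0 ltW.
- by right.
Unshelve. all: by end_near.
Qed.

End Combinations.

(** * Convex hulls *)

Section ConvexHull.
Context {R : realType} {n : nat}.
Implicit Types (A C : set 'rV[R]_n).

Lemma convex_set_comb C (x y : 'rV[R]_n) (a b : R) :
  convex_set (C : set (convex_lmodType 'rV[R]_n)) ->
  0 <= a -> 0 <= b -> a + b = 1 -> C x -> C y -> C (a *: x + b *: y).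
Proof.
move=> cC a0 b0 ab Cx Cy.
have a1 : a <= 1 by rewrite -ab lerDl.
have -> : b = 1 - a by rewrite -ab addrC addrA addNr add0r.
by have := cC x y (Itv01 a0 a1); rewrite !inE => /(_ Cx Cy).
Qed.

Lemma convex_set_sum C (K : eqType) (r : seq K) (mu : K -> R) (eta : K -> 'rV[R]_n) :
  convex_set (C : set (convex_lmodType 'rV[R]_n)) ->
  (forall i, i \in r -> 0 <= mu i /\ C (eta i)) ->
  \sum_(i <- r) mu i = 1 -> C (\sum_(i <- r) mu i *: eta i).
Proof.
move=> cC rC sr1.
(* The weights of a sublist need not sum to one, so the induction is on
   the normalised sums. *)
suff h : (\sum_(i <- r) mu i = 0 /\ \sum_(i <- r) mu i *: eta i = 0) \/
    (0 < \sum_(i <- r) mu i /\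
     C ((\sum_(i <- r) mu i)^-1 *: \sum_(i <- r) mu i *: eta i)).
  case: h => [[]|[_]]; rewrite sr1; first by move/eqP; rewrite oner_eq0.
  by rewrite invr1 scale1r.
elim: r rC {sr1} => [|i r IHr] rC; first by left; rewrite !big_nil.
have [mui Ci] := rC i (mem_head _ _).
rewrite !big_cons; case: IHr.
- by move=> j jr; apply: rC; rewrite in_cons jr orbT.
- case=> -> ->; rewrite !addr0; have [<-|mui0] := eqVneq 0 (mu i).
    by left; rewrite scale0r.
  right; rewrite lt_neqAle mui0 mui; split => //.
  by rewrite scalerA mulVf ?scale1r // eq_sym.
- set W := \sum_(j <- r) _; set X := \sum_(j <- r) _ *: _ => -[W0 CX].
  have iW0 : 0 < mu i + W by rewrite ltr_wpDl.
  right; split => //.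
  have -> : (mu i + W)^-1 *: (mu i *: eta i + X) =
      ((mu i + W)^-1 * mu i) *: eta i + ((mu i + W)^-1 * W) *: (W^-1 *: X).
    by rewrite scalerDr !scalerA mulfK // gt_eqF.
  apply: convex_set_comb => //.
  + by rewrite mulr_ge0 // invr_ge0 ltW.
  + by rewrite mulr_ge0 // ?invr_ge0 ltW.
  + by rewrite -mulrDr mulVf // gt_eqF.
Qed.

Lemma sub_conv_hull A : A `<=` conv_hull A.
Proof. by move=> x Ax C [_]; apply. Qed.

Lemma conv_hull_convex A : convex_set (conv_hull A : set (convex_lmodType 'rV[R]_n)).
Proof.
move=> x y t; rewrite !inE => Ax Ay C CA; have [cC _] := CA.
by rewrite -[C _]in_setE; apply: cC; rewrite in_setE; [exact: Ax|exact: Ay].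
Qed.

(** The set of convex combinations of points of [A] is itself convex and
    contains [A], hence contains the smallest such set. *)
Lemma conv_hull_comb A x : conv_hull A x ->
  exists m (mu : 'I_m -> R) (eta : 'I_m -> 'rV[R]_n),
    [/\ forall i, 0 <= mu i /\ A (eta i), \sum_i mu i = 1 &
        x = \sum_i mu i *: eta i].
Proof.
pose C x := exists m (mu : 'I_m -> R) (eta : 'I_m -> 'rV[R]_n),
    [/\ forall i, 0 <= mu i /\ A (eta i), \sum_i mu i = 1 &
        x = \sum_i mu i *: eta i].
move=> /(_ C); apply; split; last first.
  move=> y Ay; exists 1%N, (fun=> 1), (fun=> y); split => //.
    by rewrite big_ord1.
  by rewrite big_ord1 scale1r.
move=> {}x y t; rewrite !inE => -[m [mu [eta [muP mu1 ->]]]] [k [nu [zeta [nuP nu1 ->]]]].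
have t0 : 0 <= t%:num by [].
have t1 : 0 <= 1 - t%:num by rewrite subr_ge0.
exists (m + k)%N, (fun i => match fintype.split i with
  | inl j => t%:num * mu j | inr j => (1 - t%:num) * nu j end),
  (fun i => match fintype.split i with inl j => eta j | inr j => zeta j end).
have spl (j : 'I_m) : fintype.split (lshift k j) = inl j by exact: (unsplitK (inl j)).
have spr (j : 'I_k) : fintype.split (rshift m j) = inr j by exact: (unsplitK (inr j)).
split.
- by move=> i; case: (fintype.split i) => j; [have [] := muP j|have [] := nuP j] => ? ?;
    split => //; exact: mulr_ge0.
- rewrite big_split_ord /=.
  under eq_bigr do rewrite spl.
  under [X in _ + X]eq_bigr do rewrite spr.
  by rewrite -!mulr_sumr mu1 nu1 !mulr1 addrC subrK.
- transitivity (t%:num *: (\sum_i mu i *: eta i) +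
      (1 - t%:num) *: (\sum_i nu i *: zeta i)); first by [].
  rewrite big_split_ord /= !scaler_sumr.
  by congr (_ + _); apply: eq_bigr => j _; rewrite ?spl ?spr scalerA.
Qed.

(** Lifting the points to height one turns convex combinations into conic ones
    in dimension [n + 1], where an independent family has at most [n + 1]
    members. The fixed number of points is what allows passing to limits. *)
Lemma caratheodory A x : conv_hull A x ->
  exists (mu : 'I_n.+1 -> R) (eta : 'I_n.+1 -> 'rV[R]_n),
    [/\ forall i, 0 <= mu i /\ A (eta i), \sum_i mu i = 1 &
        x = \sum_i mu i *: eta i].
Proof.
move=> /conv_hull_comb[m [mu [eta [muP mu1 xE]]]].
have [|||T [d [_ d0 indT sumE]]] := @conic_caratheodory R 'rV[R]_(n + 1) 'I_m
    [set: 'I_m]%SET finset.set0 (fun i => pairv (eta i) 1) mu.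
- by move=> i _; rewrite inE.
- by move=> c _ i; rewrite inE.
- by move=> i _; case: (muP i).
have {}d0 i : i \in T -> 0 <= d i by move/d0.
have {}indT : (#|T| <= n.+1)%N.
  have := lin_indep_card indT.
  by rewrite finset.setU0 dimvf dim_matrix mul1r addn1.
rewrite !finset.setU0 in sumE.
have sumT (V : nmodType) (F : 'I_m -> V) : \sum_(i in [set: 'I_m]%SET) F i = \sum_i F i.
  by apply: eq_bigl => i; rewrite inE.
have d1 : \sum_(i in T) d i = 1.
  move/(congr1 (fun w => rsubmx w 0 0)) : sumE.
  rewrite !linear_sum !summxE /=.
  under eq_bigr do rewrite linearZ /= row_mxKr !mxE mulr1.
  under [RHS]eq_bigr do rewrite linearZ /= row_mxKr !mxE mulr1.
  by rewrite sumT mu1 => <-.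
have dx : \sum_(i in T) d i *: eta i = x.
  move/(congr1 lsubmx) : sumE; rewrite !linear_sum /=.
  under eq_bigr do rewrite linearZ /= row_mxKl.
  under [RHS]eq_bigr do rewrite linearZ /= row_mxKl.
  by rewrite sumT -xE => <-.
have [i0 i0T] : exists i0, i0 \in T.
  apply: contrapT => nT; move/eqP: d1; rewrite big1 ?(eq_sym 0) ?oner_eq0 //.
  by move=> i iT; case: nT; exists i.
pose e := enum T.
have sz : (size e <= n.+1)%N by rewrite -cardE.
have sumE' (V : nmodType) (F : 'I_m -> V) :
    \sum_(j < n.+1) (if (j < size e)%N then F (nth i0 e j) else 0) = \sum_(i in T) F i.
  rewrite -big_mkcond -(big_ord_widen _ (fun j => F (nth i0 e j))) //.
  by rewrite -(big_mkord xpredT (fun j => F (nth i0 e j))) -(big_nth i0 xpredT) big_enum.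
exists (fun j => if (j < size e)%N then d (nth i0 e j) else 0), (fun j => eta (nth i0 e j)).
split.
- move=> j; split; last by case: (muP (nth i0 e j)).
  by case: ifP => // jlt; apply: d0; rewrite -mem_enum mem_nth.
- by rewrite sumE'.
- rewrite -dx -sumE'; apply: eq_bigr => j _; case: ifP => // _.
  by rewrite scale0r.
Qed.

(** For bounded families, limits of points of the hulls stay in the hull of the
    outer limit: by Caratheodory the points are combinations of [n + 1]
    generators, and weights and generators converge along a subsequence. This
    transfers closedness from the limiting to the Clarke subdifferential. *)
Lemma conv_hull_limit A (G : nat -> set 'rV[R]_n) (M : R) (x : nat -> 'rV[R]_n) l :
  (\forall k \near \oo, forall y, G k y -> `|y| <= M) ->
  (forall (f : nat -> nat) (y : nat -> 'rV[R]_n) y', (forall j, (j <= f j)%N) ->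
     (forall j, G (f j) (y j)) -> y @ \oo --> y' -> A y') ->
  (forall k, conv_hull (G k) (x k)) -> x @ \oo --> l -> conv_hull A l.
Proof.
move=> GM GA Gx xl.
have /ex_choice[mu /ex_choice[eta xP]] := fun k => caratheodory (Gx k).
have [|f fge [eta' etal]] := @bounded_subseq_fam R 'I_n.+1 [set: 'I_n.+1]%SET n eta.
  move=> i _; exists M; apply: filterS GM => k; apply.
  by case: (xP k) => /(_ i)[].
have [|g gge [mu' mul]] :=
    @bounded_subseq_seq R 'I_n.+1 (index_enum 'I_n.+1) (fun j => mu (f j)).
  move=> i _; exists 1 => k; case: (xP (f k)) => muP <- _.
  rewrite ger0_norm; last by case: (muP i).
  by rewrite (bigD1 i) //= lerDl sumr_ge0 // => j _; case: (muP j).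
have {}etal i : eta (f (g j)) i @[j --> \oo] --> eta' i.
  by apply: (@subseq_cvg _ g (fun j => eta (f j) i)) => //; exact: etal.
have {}mul i : mu (f (g j)) i @[j --> \oo] --> mu' i by apply: mul; exact: mem_index_enum.
have fgge j : (j <= f (g j))%N by exact: leq_trans (gge j) (fge _).
have -> : l = \sum_i mu' i *: eta' i.
  have h : \sum_i mu (f (g j)) i *: eta (f (g j)) i @[j --> \oo] -->
      \sum_i mu' i *: eta' i.
    by apply: cvg_big_sum => i _; apply: cvgZ.
  apply: norm_cvg_unique h.
  have E j : \sum_i mu (f (g j)) i *: eta (f (g j)) i = x (f (g j)).
    by case: (xP (f (g j))).
  rewrite /=; under eq_cvg do rewrite E.
  exact: (@subseq_cvg _ (f \o g)).
apply: convex_set_sum; first exact: conv_hull_convex.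
- move=> i _; split.
    by apply: (cvg_ge0 (mul i)); apply: nearW => j; case: (xP (f (g j))) => /(_ i)[].
  apply: sub_conv_hull; apply: (GA (f \o g) (fun j => eta (f (g j)) i)) => //.
  by move=> j; case: (xP (f (g j))) => /(_ i)[].
- have h : \sum_i mu (f (g j)) i @[j --> \oo] --> \sum_i mu' i.
    by apply: (@cvg_big_sum R R^o) => i _; exact: mul.
  have E j : \sum_i mu (f (g j)) i = 1 by case: (xP (f (g j))).
  apply: (norm_cvg_unique h); rewrite /=; under eq_cvg do rewrite E.
  exact: cvg_cst.
Qed.

Lemma conv_hull_norm A (M : R) x : (forall y, A y -> `|y| <= M) ->
  conv_hull A x -> `|x| <= M.
Proof.
move=> AM /conv_hull_comb[m [mu [eta [muP mu1 ->]]]].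
apply: le_trans (ler_norm_sum _ _ _) _.
rewrite -[M]mul1r -mu1 mulr_suml; apply: ler_sum => i _.
have [mui Ai] := muP i.
by rewrite normrZ ger0_norm // ler_wpM2l // AM.
Qed.

End ConvexHull.

(** * Vectors of the product space and normal cones *)

Section Pairs.
Context {R : realType} {n : nat}.
Implicit Types (x y h : 'rV[R]_n) (s t : R).

Lemma dotvE (m : nat) (x y : 'rV[R]_m) : dotv x y = \sum_j x 0 j * y 0 j.
Proof. by rewrite /dotv mxE; apply: eq_bigr => j _; rewrite mxE. Qed.

Lemma dotv_pairv x y s t : dotv (pairv x s) (pairv y t) = dotv x y + s * t.
Proof.
by rewrite /dotv /pairv tr_row_mx mul_row_col mxE [X in _ + X]mxE big_ord1 !mxE.
Qed.

Lemma dotvZr x y s : dotv x (s *: y) = s * dotv x y.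
Proof. by rewrite /dotv linearZ /= -scalemxAr mxE. Qed.

Lemma dotvDl x y h : dotv (x + y) h = dotv x h + dotv y h.
Proof. by rewrite /dotv mulmxDl mxE. Qed.

Lemma dotvZl x y s : dotv (s *: x) y = s * dotv x y.
Proof. by rewrite /dotv -scalemxAl mxE. Qed.

Lemma dotv_delta x j : dotv x (delta_mx 0 j) = x 0 j.
Proof.
rewrite dotvE (bigD1 j) //= mxE !eqxx mulr1 big1 ?addr0 // => i /negbTE ij.
by rewrite mxE ij andbF mulr0.
Qed.

Lemma dotv_norm_le x y : `|dotv x y| <= (\sum_j `|x 0 j|) * `|y|.
Proof.
rewrite dotvE mulr_suml; apply: le_trans (ler_norm_sum _ _ _) _.
by apply: ler_sum => j _; rewrite normrM ler_wpM2l // mx_entry_le.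
Qed.

Lemma norm_delta (j : 'I_n) : `|delta_mx 0 j : 'rV[R]_n| = 1.
Proof.
apply/eqP; rewrite eq_le; apply/andP; split.
  by apply: mx_norm_leP => // i k; rewrite mxE; case: (_ && _); rewrite /= ?normr0 ?normr1 ?ler01.
by apply: le_trans _ (mx_entry_le _ 0 j); rewrite mxE !eqxx normr1.
Qed.

Lemma pairv_eta (w : 'rV[R]_(n + 1)) : w = pairv (lsubmx w) (rsubmx w 0 0).
Proof.
rewrite -[LHS]hsubmxK /pairv; congr row_mx; apply/matrixP => i j.
by rewrite (ord1 i) (ord1 j) !mxE.
Qed.

Lemma lsub_pairv x s : lsubmx (pairv x s) = x.
Proof. exact: row_mxKl. Qed.

Lemma rsub_pairv x s : rsubmx (pairv x s) 0 0 = s.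
Proof. by rewrite row_mxKr mxE. Qed.

Lemma pairvB x y s t : pairv x s - pairv y t = pairv (x - y) (s - t).
Proof.
rewrite /pairv opp_row_mx add_row_mx; congr row_mx; apply/matrixP => i j.
by rewrite !mxE.
Qed.

Lemma norm_pairv_ge x s : `|x| <= `|pairv x s|.
Proof.
apply: mx_norm_leP => // i j.
by have := mx_entry_le (pairv x s) i (lshift 1 j); rewrite row_mxEl.
Qed.

Lemma norm_pairv_le x s : `|pairv x s| <= `|x| + `|s|.
Proof.
apply: mx_norm_leP; first exact: addr_ge0.
move=> i j; rewrite -(splitK j); case: (fintype.split j) => k /=.
  by rewrite row_mxEl; apply: le_trans (mx_entry_le _ _ _) _; rewrite lerDl.
by rewrite row_mxEr mxE lerDr.
Qed.

Lemma cvg_pairv (u : nat -> 'rV[R]_n) (t : nat -> R) x s :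
  u @ \oo --> x -> t @ \oo --> s -> pairv (u k) (t k) @[k --> \oo] --> pairv x s.
Proof.
move=> ux ts; apply: cvg_mx => i j; rewrite -(splitK j).
case: (fintype.split j) => k /=.
  rewrite row_mxEl; under eq_cvg do rewrite row_mxEl; exact: cvg_entry.
rewrite row_mxEr mxE; under eq_cvg do rewrite row_mxEr mxE; exact: ts.
Qed.

Lemma cvg_lsub (w : nat -> 'rV[R]_(n + 1)) x s :
  w @ \oo --> pairv x s -> lsubmx (w k) @[k --> \oo] --> x.
Proof.
move=> wx; apply: cvg_mx => i j; rewrite -(row_mxEl x (const_mx s : 'rV[R]_1)).
under eq_cvg do rewrite mxE; exact: cvg_entry.
Qed.

Lemma cvg_rsub (w : nat -> 'rV[R]_(n + 1)) x s :
  w @ \oo --> pairv x s -> rsubmx (w k) 0 0 @[k --> \oo] --> s.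
Proof.
move=> wx; rewrite -[s in _ --> s](rsub_pairv x s) mxE.
under eq_cvg do rewrite mxE; exact: cvg_entry.
Qed.

Lemma near0_scale (P : 'rV[R]_n -> Prop) h :
  (\forall k \near (0 : 'rV[R]_n), P k) -> exists2 s : R, 0 < s & P (s *: h).
Proof.
move=> /nbhs_ballP[d /= d0 dP]; have h1 : 0 < `|h| + 1 by rewrite ltr_wpDl.
exists (d / (`|h| + 1)); first exact: divr_gt0.
apply: dP; rewrite -ball_normE /= sub0r normrN normrZ gtr0_norm ?divr_gt0 //.
by rewrite -mulrA gtr_pMr // mulrC ltr_pdivrMr // mul1r ltrDl.
Qed.

(** Moving a short distance in the direction of [x] itself gives
    [dotv x x <= 0]. *)
Lemma dotv_small_eq0 x :
  (forall e : R, 0 < e -> \forall h \near (0 : 'rV[R]_n), dotv x h <= e * `|h|) -> x = 0.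
Proof.
move=> xs; have : dotv x x <= 0.
  apply/ler_addgt0Pr => e e0; rewrite add0r.
  have h1 : 0 < `|x| + 1 by rewrite ltr_wpDl.
  have [s s0] := near0_scale x (xs (e / (`|x| + 1)) (divr_gt0 e0 h1)).
  rewrite dotvZr normrZ gtr0_norm // mulrCA ler_pM2l // => /le_trans; apply.
  by rewrite -mulrA ger_pMr // mulrC ler_pdivrMr // mul1r lerDl.
rewrite dotvE => s0; apply/rowP => j; rewrite mxE; apply/eqP.
have : \sum_j x 0 j * x 0 j == 0.
  by rewrite eq_le s0 sumr_ge0 // => i _; rewrite -expr2 sqr_ge0.
rewrite psumr_eq0 => [/allP/(_ j (mem_index_enum _))/=|i _].
  by rewrite mulf_eq0 orbb.
by rewrite -expr2 sqr_ge0.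
Qed.

End Pairs.

(** Diagonal argument: the k-th normal is within [1 / (k + 1)] of a regular
    normal at a point within [1 / (k + 1)] of the k-th base point. *)
Lemma limiting_normal_cone_closed (R : realType) n (A : set 'rV[R]_n)
    (zs xis : nat -> 'rV[R]_n) z xi :
  zs @ \oo --> z -> xis @ \oo --> xi ->
  (forall k, limiting_normal_cone A (zs k) (xis k)) -> limiting_normal_cone A z xi.
Proof.
move=> zsz xisx N.
have /ex_choice[p pP] : forall k, exists p : 'rV[R]_n * 'rV[R]_n,
    [/\ `|zs k - p.1| < k.+1%:R^-1, `|xis k - p.2| < k.+1%:R^-1, A p.1 &
        regular_normal_cone A p.1 p.2].
  move=> k; have [a [b [az bx abP]]] := N k.
  have k0 : 0 < k.+1%:R^-1 :> R by rewrite invr_gt0.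
  move/cvgrPdist_lt/(_ _ k0) : az => az; move/cvgrPdist_lt/(_ _ k0) : bx => bx.
  have [N0 _ N0P] := filterI az bx.
  have [abz abx] := N0P N0 (leqnn _); have [Aa Rab] := abP N0.
  by exists (a N0, b N0).
have key (u v : nat -> 'rV[R]_n) (l : 'rV[R]_n) : u @ \oo --> l ->
    (forall k, `|u k - v k| < k.+1%:R^-1) -> v @ \oo --> l.
  move=> ul uv; have -> : v = u \- (u \- v) by apply/funext => k /=; rewrite subKr.
  rewrite -[l]subr0; apply: cvgB => //; apply/cvgr0Pnorm_lt => e e0.
  near=> k; apply: lt_trans (uv k) _.
  by near: k; exact: near_infty_natSinv_lt (PosNum e0).
exists (fun k => (p k).1), (fun k => (p k).2); split.
- by apply: key zsz _ => k; case: (pP k).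
- by apply: key xisx _ => k; case: (pP k).
- by move=> k; case: (pP k).
Unshelve. all: by end_near.
Qed.

Section EpigraphNormals.
Context {R : realType} {n : nat}.
Implicit Types (psi : 'rV[R]_n -> \bar R) (x z h xi : 'rV[R]_n).

(** The only way regular normals to an epigraph are exploited: they are tested
    against the points [(x + h, t + g h)], where [g] bounds the increment of
    [psi] and is at most linear, so that the distance to the base point is
    comparable to [`|h|]. *)
Lemma epi_normal_test psi x t xi (tau : R) (g : 'rV[R]_n -> R) (L : R) :
  0 <= L -> regular_normal_cone (epi psi) (pairv x t) (pairv xi tau) ->
  (\forall h \near (0 : 'rV[R]_n), (psi (x + h)%R <= (t + g h)%:E)%E /\ `|g h| <= L * `|h|) ->
  forall e : R, 0 < e -> \forall h \near (0 : 'rV[R]_n), dotv xi h + tau * g h <= e * `|h|.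
Proof.
move=> L0 N gP e e0; have L1 : 0 < 1 + L by rewrite ltr_pwDl.
have /nbhs_ballP[d /= d0 dP] := N _ (divr_gt0 e0 L1).
have : \forall h \near (0 : 'rV[R]_n), `|h| < d / (1 + L).
  by apply/nbhs_norm0P; exists (d / (1 + L)) => //=; exact: divr_gt0.
apply: filterS2 gP => h [gh ghL] hd.
have E : pairv (x + h) (t + g h) - pairv x t = pairv h (g h).
  by rewrite pairvB [x + h]addrC [t + _]addrC !addrK.
have Eh : `|pairv h (g h)| <= (1 + L) * `|h|.
  by apply: le_trans (norm_pairv_le _ _) _; rewrite mulrDl mul1r lerD2l.
have := dP (pairv (x + h) (t + g h)); rewrite E dotv_pairv => H.
apply: le_trans (H _ _) _.
- rewrite -ball_normE /= -normrN opprB E; apply: le_lt_trans Eh _.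
  by rewrite mulrC -ltr_pdivlMr.
- by rewrite /epi /= lsub_pairv rsub_pairv.
- by rewrite -mulrA ler_wpM2l ?(ltW e0) // mulrC ler_pdivrMr // mulrC.
Qed.

Definition calm_at psi (L : R) x : Prop :=
  \forall h \near (0 : 'rV[R]_n),
    [/\ psi x \is a fin_num, psi (x + h) \is a fin_num &
        `|fine (psi (x + h)) - fine (psi x)| <= L * `|h|].

Lemma lipschitz_near_calm psi z : lipschitz_near psi z ->
  exists2 L : R, 0 <= L & \forall x \near z, calm_at psi L x.
Proof.
case=> U [nU finU lipU].
have [L L0 LU] : exists2 L : R, 0 <= L & forall x y, U x -> U y ->
    `|fine (psi x) - fine (psi y)| <= L * `|x - y|.
  have [M [_ MU]] := lipU.
  exists (Num.max M 0 + 1); first by rewrite addr_ge0 // le_max lexx orbT.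
  move=> x y Ux Uy; apply: (MU (Num.max M 0 + 1) _ (x, y)) => //=.
  by rewrite (@le_lt_trans _ _ (Num.max M 0)) ?le_max ?lexx // ltrDl.
exists L => //; move/nbhs_interior : nU; apply: filterS => x nUx.
have Ux := nbhs_singleton nUx.
have : \forall h \near (0 : 'rV[R]_n), U (x + h) by move/nbhs0P : nUx.
apply: filterS => h Uxh; split; [exact: finU|exact: finU|].
by apply: le_trans (LU _ _ Uxh Ux) _; rewrite [x + h]addrC addrK.
Qed.

End EpigraphNormals.

(** * The limiting subdifferential *)

Section LimitingSubdiff.
Context {R : realType} {n : nat}.
Implicit Types (psi : 'rV[R]_n -> \bar R) (x z h xi : 'rV[R]_n).

(** Differentiability is used through this expansion because it is stable under
    [psi |-> - psi] without any computation of directional derivatives. *)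
Definition frechet_gradient psi x (g : 'rV[R]_n) : Prop :=
  psi x \is a fin_num /\
  forall e : R, 0 < e -> \forall h \near (0 : 'rV[R]_n),
    `|fine (psi (x + h)) - fine (psi x) - dotv g h| <= e * `|h|.

(** Testing with [g h = L * `|h|] shows that a regular normal [(xi, tau)] grows
    at most like [- tau * L]. *)
Lemma epi_normal_lipschitz psi x t xi (tau L : R) : 0 <= L ->
  calm_at psi L x ->
  epi psi (pairv x t) -> regular_normal_cone (epi psi) (pairv x t) (pairv xi tau) ->
  forall j, `|xi 0 j| <= - tau * L.
Proof.
move=> L0 lipx; rewrite /epi /= lsub_pairv rsub_pairv => xt N.
have test v : dotv xi v <= - tau * L * `|v|.
  apply/ler_addgt0Pr => e e0.
  have v1 : 0 < `|v| + 1 by rewrite ltr_wpDl.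
  have [|s s0] := near0_scale v
      (epi_normal_test (g := fun h => L * `|h|) L0 N _ (divr_gt0 e0 v1)).
    apply: filterS lipx => h [fx fxh lip]; split.
      rewrite -(fineK fxh) lee_fin; move: xt; rewrite -(fineK fx) lee_fin => xt.
      have := ler_norm (fine (psi (x + h)) - fine (psi x)); lra.
    by rewrite ger0_norm // mulr_ge0.
  rewrite dotvZr normrZ gtr0_norm // => H.
  have : s * (dotv xi v + tau * L * `|v|) <= s * (e / (`|v| + 1) * `|v|).
    by apply: le_trans (le_trans _ H) _; rewrite le_eqVlt; apply/orP; left; apply/eqP; ring.
  rewrite ler_pM2l // => {}H.
  have : e / (`|v| + 1) * `|v| <= e.
    by rewrite -mulrA ger_pMr // mulrC ler_pdivrMr // mul1r lerDl.
  move: H; rewrite !mulNr; lra.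
move=> j; rewrite ler_norml; apply/andP; split.
  have := test (- delta_mx 0 j); rewrite normrN norm_delta mulr1 -scaleN1r dotvZr.
  by rewrite dotv_delta mulN1r lerNl.
by have := test (delta_mx 0 j); rewrite norm_delta mulr1 dotv_delta.
Qed.

(** The bound on regular normals passes to the limit [tau = -1]. *)
Lemma limiting_subdiff_bounded psi zbar : lipschitz_near psi zbar ->
  exists M : R, \forall z \near zbar, forall xi, limiting_subdiff psi z xi -> `|xi| <= M.
Proof.
move=> /lipschitz_near_calm[L L0 /nbhs_interior lipL]; exists L.
apply: filterS lipL => z lipz xi [_ [ws [xs [wsz xsz wP]]]].
apply: mx_norm_leP => // i j; rewrite (ord1 i) -subr_ge0.
have h : - rsubmx (xs k) 0 0 * L - `|lsubmx (xs k) 0 j| @[k --> \oo] --> - (-1) * L - `|xi 0 j|.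
  apply: cvgB; first exact: cvgM (cvgN (cvg_rsub xsz)) (cvg_cst L).
  by apply: cvg_norm; apply: cvg_entry; exact: cvg_lsub xsz.
rewrite opprK mul1r in h; refine (cvg_ge0 h _).
have near_lip : \forall k \near \oo, calm_at psi L (lsubmx (ws k)).
  exact: (cvg_lsub wsz lipz).
apply: filterS near_lip => k lipk.
have [ek Nk] := wP k; rewrite subr_ge0.
rewrite [ws k]pairv_eta in ek Nk; rewrite [xs k]pairv_eta in Nk.
exact: epi_normal_lipschitz L0 lipk ek Nk j.
Qed.

Lemma lipschitz_near_fin psi zbar :
  lipschitz_near psi zbar -> psi zbar \is a fin_num.
Proof. by case=> U [/nbhs_singleton Uz finU _]; exact: finU. Qed.

Lemma lipschitz_near_cvg psi zbar (zs : nat -> 'rV[R]_n) :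
  lipschitz_near psi zbar -> zs @ \oo --> zbar ->
  fine (psi (zs k)) @[k --> \oo] --> fine (psi zbar).
Proof.
move=> /lipschitz_near_calm[L L0 /nbhs_singleton/= lipL] zsz.
have L1 : 0 < L + 1 by rewrite ltr_wpDl.
apply/cvgrPdist_lt => e e0.
have eL : 0 < e / (L + 1) by exact: divr_gt0.
have lipz : \forall x \near zbar, `|fine (psi x) - fine (psi zbar)| <= L * `|x - zbar|.
  apply/nbhs0P; apply: filterS lipL => h [_ _].
  by rewrite [zbar + h - zbar]addrC addKr.
have lipk : \forall k \near \oo,
    `|fine (psi (zs k)) - fine (psi zbar)| <= L * `|zs k - zbar| := zsz _ lipz.
move/cvgrPdist_lt/(_ _ eL) : zsz; apply: filterS2 lipk => k lipk zk.
rewrite distrC; apply: le_lt_trans lipk _; rewrite distrC.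
rewrite ltr_pdivlMr // in zk; apply: le_lt_trans zk.
by rewrite mulrC ler_wpM2l // lerDl.
Qed.

Lemma limiting_subdiff_closed psi zbar (zs xis : nat -> 'rV[R]_n) xi :
  lipschitz_near psi zbar -> zs @ \oo --> zbar -> xis @ \oo --> xi ->
  (forall k, limiting_subdiff psi (zs k) (xis k)) -> limiting_subdiff psi zbar xi.
Proof.
move=> lip zsz xisx sub; split; first exact: lipschitz_near_fin.
apply: (@limiting_normal_cone_closed _ _ (epi psi)
  (fun k => pairv (zs k) (fine (psi (zs k)))) (fun k => pairv (xis k) (-1))).
- by apply: cvg_pairv => //; exact: lipschitz_near_cvg.
- by apply: cvg_pairv => //; exact: cvg_cst.
- by move=> k; case: (sub k).
Qed.

(** Testing regular normals with the true increment of [psi] gives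
    [xi + tau * G x = 0]; letting [tau] tend to [-1] and using continuity of [G]
    identifies every limiting subgradient. Conversely [(G z, -1)] is already a
    regular normal at [z]. *)
Lemma limiting_subdiff_gradient psi (G : 'rV[R]_n -> 'rV[R]_n) z :
  (\forall x \near z, frechet_gradient psi x (G x)) ->
  {for z, continuous G} -> limiting_subdiff psi z = [set G z].
Proof.
move=> diffz Gz; apply/seteqP; split => [xi [_ [ws [xs [wsz xsz wP]]]]|_ ->].
- have lsz := cvg_lsub wsz; have rsx := cvg_rsub xsz; have lsx := cvg_lsub xsz.
  have E : \forall k \near \oo,
      lsubmx (xs k) + rsubmx (xs k) 0 0 *: G (lsubmx (ws k)) = 0.
    have near_diff : \forall k \near \oo, \forall x \near lsubmx (ws k),
        frechet_gradient psi x (G x).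
      exact: lsz (nbhs_interior diffz).
    apply: filterS near_diff => k diffk.
    have [ek Nk] := wP k.
    rewrite [ws k]pairv_eta in ek Nk; rewrite [xs k]pairv_eta in Nk.
    move: ek Nk diffk; set x := lsubmx _; set t := rsubmx _ _ _.
    set eta := lsubmx _; set tau := rsubmx _ _ _ => ek Nk diffk.
    have [finx diffx] := nbhs_singleton diffk.
    apply: dotv_small_eq0 => e e0.
    have e20 : 0 < e / 2 by rewrite divr_gt0.
    have tau1 : 0 < `|tau| + 1 by rewrite ltr_wpDl.
    pose L := 1 + \sum_j `|G x 0 j|.
    have L0 : 0 <= L by rewrite addr_ge0 // sumr_ge0.
    have near_inc : \forall h \near (0 : 'rV[R]_n),
        (psi (x + h)%R <= (t + (fine (psi (x + h)%R) - fine (psi x)))%:E)%E /\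
        `|fine (psi (x + h)) - fine (psi x)| <= L * `|h|.
      move/nbhs0P : diffk => diffk; apply: filterS2 diffk (diffx 1 ltr01) => h [fh _] dh.
      move: ek; rewrite /epi /= lsub_pairv rsub_pairv -(fineK finx) -(fineK fh) !lee_fin => ek.
      split; first by move: ek => /=; lra.
      have := dotv_norm_le (G x) h; rewrite /L mulrDl.
      have := ler_normD (fine (psi (x + h)) - fine (psi x) - dotv (G x) h) (dotv (G x) h).
      rewrite subrK; lra.
    apply: filterS2 (epi_normal_test L0 Nk near_inc e20)
      (diffx _ (divr_gt0 e20 tau1)) => h H1 H2; rewrite dotvDl dotvZl.
    have : `|tau * (dotv (G x) h - (fine (psi (x + h)) - fine (psi x)))| <= e / 2 * `|h|.
      rewrite normrM distrC; apply: le_trans (ler_wpM2l _ H2) _ => //.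
      rewrite mulrA ler_wpM2r // mulrCA ger_pMr // ler_pdivrMr // mul1r.
      by rewrite lerDl.
    move=> /(le_trans (ler_norm _)); lra.
  have h : lsubmx (xs k) + rsubmx (xs k) 0 0 *: G (lsubmx (ws k)) @[k --> \oo] -->
      xi + (-1) *: G z.
    by apply: cvgD => //; apply: cvgZ => //; exact: (cvg_comp _ G lsz Gz).
  have h0 : lsubmx (xs k) + rsubmx (xs k) 0 0 *: G (lsubmx (ws k)) @[k --> \oo] -->
      (0 : 'rV[R]_n) by exact: cvg_near_cst.
  have xiE : xi + (-1) *: G z = 0 := norm_cvg_unique h h0.
  by apply/eqP; rewrite -subr_eq0 -scaleN1r xiE.
- have [finz Dz] := nbhs_singleton diffz; split => //.
  exists (fun=> pairv z (fine (psi z))), (fun=> pairv (G z) (-1)).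
  split; [exact: cvg_cst|exact: cvg_cst|move=> _; split].
    by rewrite /epi /= lsub_pairv rsub_pairv fineK.
  move=> e e0.
  have := Dz e e0; move=> /nbhs_ballP[d /= d0 dP].
  have : \forall x \near z, psi x \is a fin_num by apply: filterS diffz => x [].
  move=> /nbhs_ballP[d' /= d'0 d'P].
  apply/nbhs_ballP; exists (Num.min d d') => /=; first by rewrite lt_min d0.
  move=> w; rewrite -ball_normE /= [w]pairv_eta.
  set x := lsubmx w; set t := rsubmx w 0 0 => wd.
  rewrite /epi /= lsub_pairv rsub_pairv => xt.
  have nx : `|x - z| <= `|pairv x t - pairv z (fine (psi z))|.
    by rewrite pairvB; exact: norm_pairv_ge.
  rewrite distrC in wd; have := le_lt_trans nx wd; rewrite lt_min => /andP[xd xd'].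
  have finx : psi x \is a fin_num by apply: d'P; rewrite -ball_normE /= distrC.
  have := dP (x - z); rewrite -ball_normE /= sub0r normrN => /(_ xd).
  rewrite [z + _]addrC subrK => H.
  move: xt; rewrite -(fineK finx) lee_fin => xt.
  rewrite [in leLHS]pairvB dotv_pairv mulN1r.
  apply: le_trans (ler_wpM2l (ltW e0) nx); apply: le_trans H.
  have := ler_norm (- (fine (psi x) - fine (psi z) - dotv (G z) (x - z))).
  by rewrite normrN; lra.
Qed.

End LimitingSubdiff.

(** * Common properties of the two subdifferentials *)

Section Subdiff.
Context {R : realType} {n : nat}.
Implicit Types (psi : 'rV[R]_n -> \bar R) (x z h xi : 'rV[R]_n) (box : subdiff_kind).

Lemma subdiff_bounded box psi zbar : lipschitz_near psi zbar ->
  exists M : R, \forall z \near zbar, forall xi, subdiff box psi z xi -> `|xi| <= M.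
Proof.
move=> /limiting_subdiff_bounded[M subM]; exists M; case: box => //=.
by apply: filterS subM => z subM xi; apply: conv_hull_norm => y; exact: subM.
Qed.

Lemma subdiff_closed box psi zbar (zs xis : nat -> 'rV[R]_n) xi :
  lipschitz_near psi zbar -> zs @ \oo --> zbar -> xis @ \oo --> xi ->
  (forall k, subdiff box psi (zs k) (xis k)) -> subdiff box psi zbar xi.
Proof.
case: box => lip zsz xisx /= sub; first exact: limiting_subdiff_closed sub.
have [M subM] := limiting_subdiff_bounded lip.
have near_subM : \forall k \near \oo, forall xi,
    limiting_subdiff psi (zs k) xi -> `|xi| <= M := zsz _ subM.
apply: conv_hull_limit near_subM _ sub xisx => f y y' fge fy yy'.
by apply: (limiting_subdiff_closed lip _ yy' fy); exact: subseq_cvg.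
Qed.

Lemma subdiff_gradient box psi (G : 'rV[R]_n -> 'rV[R]_n) z :
  (\forall x \near z, frechet_gradient psi x (G x)) ->
  {for z, continuous G} -> subdiff box psi z = [set G z].
Proof.
move=> Gx Gz; have E := limiting_subdiff_gradient Gx Gz.
case: box => //=; rewrite /clarke_subdiff E; apply/seteqP; split => [xi|_ ->]; last first.
  exact: sub_conv_hull.
case/conv_hull_comb => m [mu [eta [muP mu1 ->]]] /=.
under eq_bigr => i _ do rewrite (muP i).2.
by rewrite -scaler_suml mu1 scale1r.
Qed.

Lemma diff_gradient psi x h : differentiable (fun x => fine (psi x) : R^o) x ->
  'd (fun x => fine (psi x) : R^o) x h = dotv (grad psi x) h :> R.
Proof.
move=> dx; rewrite {1}[h]row_sum_delta linear_sum dotvE; apply: eq_bigr => j _.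
by rewrite linearZ /= -deriveE // mxE mulrC.
Qed.

Lemma differentiable_frechet psi x : psi x \is a fin_num ->
  differentiable (fun x => fine (psi x) : R^o) x -> frechet_gradient psi x (grad psi x).
Proof.
move=> finx dx; split => // e e0.
have /eqaddoP/(_ _ e0) := diff_locally dx; apply: filterS => h.
by rewrite -diff_gradient // !fctE /= [h + x]addrC opprD addrA.
Qed.

Lemma frechet_gradientN psi x g :
  frechet_gradient psi x g -> frechet_gradient (fun x => - psi x)%E x (- g).
Proof.
move=> [finx gx]; split=> [|e e0]; first by rewrite fin_numN.
move: (gx e e0); apply: filterS => h.
have -> : dotv (- g) h = - dotv g h by rewrite -scaleN1r dotvZl mulN1r.
by rewrite !fineN -!opprD normrN.
Qed.

Lemma cont_differentiable_subdiff psi zbar : cont_differentiable_near psi zbar ->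
  \forall z \near zbar, forall box,
    subdiff box psi z = [set grad psi z] /\
    subdiff box (fun x => - psi x)%E z = [set - grad psi z].
Proof.
move=> /nbhs_interior; apply: filterS => z C1.
have [_ _ cz] := nbhs_singleton C1.
have near_frechet : \forall x \near z, frechet_gradient psi x (grad psi x).
  by apply: filterS C1 => x [finx dx _]; exact: differentiable_frechet.
move=> box; split; first exact: subdiff_gradient.
apply: (@subdiff_gradient box _ (fun x => - grad psi x)); last exact: continuousN cz.
by apply: filterS near_frechet => x; exact: frechet_gradientN.
Qed.

End Subdiff.

(** * Multipliers *)

Section Multipliers.
Context {R : realType} {n p q : nat}.
Variables (phi : 'I_(p + q).+1 -> 'rV[R]_n -> \bar R) (box : subdiff_kind).
Variable zbar : 'rV[R]_n.

Local Notation A := (active phi zbar).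
Local Notation J := (eq_idx p q).

Definition generators (z : 'rV[R]_n) (xi : 'I_(p + q).+1 -> 'rV[R]_n) i :=
  if i \in A then xi i else grad (phi i) z.

Definition eq_subdiff_at (z : 'rV[R]_n) : Prop :=
  forall i, i \in J -> subdiff box (phi i) z = [set grad (phi i) z] /\
    subdiff box (fun x => - phi i x)%E z = [set - grad (phi i) z].

(** The multipliers of equality constraints are absorbed into sign-free
    coefficients on the basis [Jt] of their gradients. *)
Definition independent_rep (Jt : {set 'I_(p + q).+1}) z w
    (xi : 'I_(p + q).+1 -> 'rV[R]_n) (T : {set 'I_(p + q).+1})
    (d : 'I_(p + q).+1 -> R) : Prop :=
  [/\ forall i, i \in A -> subdiff box (phi i) z (xi i),
      T \subset A, forall i, i \in T -> 0 <= d i,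
      lin_indep (T :|: Jt) (generators z xi) &
      w = \sum_(i in T :|: Jt) d i *: generators z xi i].

Lemma active_notin_eq i : i \in A -> i \notin J.
Proof. by rewrite !inE => /andP[/andP[_ ip] _]; rewrite ltnNge ip. Qed.

Lemma eq_notin_active i : i \in J -> i \notin A.
Proof. by move=> iJ; apply/negP => /active_notin_eq; rewrite iJ. Qed.

(** Under the constant rank condition the equality part can be rewritten over
    [Jt] alone, and the Caratheodory reduction removes superfluous active
    inequality constraints without touching [Jt]. *)
Lemma Mbar_independent (Jt : {set 'I_(p + q).+1}) z w :
  Jt \subset J -> eq_subdiff_at z ->
  lin_indep Jt (fun i => grad (phi i) z) ->
  (\dim <<[seq grad (phi i) z | i in J]>>%VS <= #|Jt|)%N ->
  Mbar phi box zbar z w ->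
  exists xi T d, independent_rep Jt z w xi T d.
Proof.
move=> JtJ eqz indJt dimJ [lam [xi [lam0 xiA xiJ ->]]].
have dAJt : {in A, forall i, i \notin Jt}.
  by move=> i /active_notin_eq; apply: contra; exact: (fintype.subsetP JtJ).
have genJ i : i \in Jt -> generators z xi i = grad (phi i) z.
  by move=> /(fintype.subsetP JtJ)/eq_notin_active/negbTE; rewrite /generators => ->.
have /ex_choice[b bE] : forall i, exists b : 'I_(p + q).+1 -> R, i \in J ->
    lam i *: xi i = \sum_(j in Jt) b j *: grad (phi j) z.
  move=> i; case: (boolP (i \in J)) => [iJ|_]; last by exists (fun=> 0).
  have [c cE] := span_full_rank JtJ indJt dimJ iJ.
  have [E EN] := eqz i iJ; have := xiJ i iJ; rewrite E EN => -[] /= ->.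
    exists (fun j => lam i * c j) => _; rewrite {1}cE scaler_sumr.
    by apply: eq_bigr => j _; rewrite scalerA.
  exists (fun j => - lam i * c j) => _; rewrite scalerN -scaleNr {1}cE scaler_sumr.
  by apply: eq_bigr => j _; rewrite scalerA.
pose c i := if i \in A then lam i else \sum_(j in J) b j i.
have [||T [d [TA d0 indT sumE]]] :=
    @conic_caratheodory R 'rV[R]_n _ A Jt (generators z xi) c dAJt.
- by apply: eq_lin_indep indJt => i iJt; rewrite genJ.
- by move=> i iA; rewrite /c iA lam0 // inE iA.
exists xi, T, d; split => //; rewrite -sumE sum_setU //; congr (_ + _).
  by apply: eq_bigr => i iA; rewrite /c /generators iA.
rewrite (eq_bigr _ (fun i iJ => bE i iJ)) exchange_big /=; apply: eq_bigr => j jJt.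
have jA : j \in A = false by apply/negbTE/eq_notin_active/(fintype.subsetP JtJ).
by rewrite genJ // /c jA scaler_suml.
Qed.

(** Conversely, a sign-free coefficient [d i] of an equality constraint becomes
    the nonnegative multiplier [`|d i|] of the gradient of [phi i] or of
    [- phi i]. *)
Lemma Mbar_of_generators (T Jt : {set 'I_(p + q).+1}) xi (d : 'I_(p + q).+1 -> R) :
  T \subset A -> Jt \subset J -> eq_subdiff_at zbar ->
  (forall i, i \in A -> subdiff box (phi i) zbar (xi i)) ->
  (forall i, i \in T -> 0 <= d i) ->
  Mbar phi box zbar zbar (\sum_(i in T :|: Jt) d i *: generators zbar xi i).
Proof.
move=> TA JtJ eqz xiA d0.
have TJt : {in T, forall i, i \notin Jt}.
  move=> i /(fintype.subsetP TA)/active_notin_eq; apply: contra.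
  exact: (fintype.subsetP JtJ).
exists (fun i => if i \in T :|: Jt then `|d i| else 0),
  (fun i => if i \in A then xi i else
            if 0 <= d i then grad (phi i) zbar else - grad (phi i) zbar); split.
- by move=> i _; case: ifP.
- by move=> i iA; rewrite iA; exact: xiA.
- move=> i iJ; rewrite (negbTE (eq_notin_active iJ)); have [-> ->] := eqz i iJ.
  by case: ifP => _; [left|right].
rewrite sum_setU //; congr (_ + _).
- rewrite [RHS](@sum_supset _ _ A T) //.
    apply: eq_bigr => i iT; rewrite /generators (fintype.subsetP TA _ iT) inE iT /=.
    by rewrite ger0_norm // d0.
  move=> i /active_notin_eq iJ iT; rewrite inE (negbTE iT) /= ifN ?scale0r //.
  by apply: contra iJ; exact: (fintype.subsetP JtJ).
- rewrite [RHS](@sum_supset _ _ J Jt) //.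
    apply: eq_bigr => i iJt; have iA := eq_notin_active (fintype.subsetP JtJ _ iJt).
    rewrite /generators (negbTE iA) inE iJt orbT; case: ifP => [di|/negbT].
      by rewrite ger0_norm.
    by rewrite -ltNge => di; rewrite ltr0_norm // scalerN scaleNr opprK.
  move=> i iJ iJt; rewrite inE (negbTE iJt) orbF ifN ?scale0r //.
  by apply: contra (eq_notin_active iJ); exact: (fintype.subsetP TA).
Qed.

End Multipliers.

Theorem lemma3p12 (R : realType) (n p q : nat)
    (phi : 'I_(p + q).+1 -> 'rV[R]_n -> \bar R)
    (zbar : 'rV[R]_n)
    (zbar_feasible : feasible phi zbar)
    (phi_lipschitz : forall i, \forall z \near zbar, lipschitz_near (phi i) z)
    (phi_C1 : forall i, i \in eq_idx p q ->
       cont_differentiable_near (phi i) zbar)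
    (box : subdiff_kind) :
  RCPLD phi box zbar -> asymptotically_regular phi box zbar.
Proof.
move=> [[r rank_r] [Jt [JtJ basisJt constJt]]] w [zs [ws [zsz wsw /all_and2[_ wP]]]].
have lip i : lipschitz_near (phi i) zbar := nbhs_singleton (phi_lipschitz i).
have near_eq : \forall z \near zbar, eq_subdiff_at phi box z.
  have near_eqi i : \forall z \near zbar, i \in eq_idx p q ->
      subdiff box (phi i) z = [set grad (phi i) z] /\
      subdiff box (fun x => - phi i x)%E z = [set - grad (phi i) z].
    case: (boolP (i \in eq_idx p q)) => [iJ|_]; last by apply: filterS filterT.
    by apply: filterS (cont_differentiable_subdiff (phi_C1 i iJ)) => z + _; apply.
  exact: filter_forall near_eqi.
have gradJ (us : nat -> 'rV[R]_n) i : us @ \oo --> zbar -> i \in Jt ->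
    grad (phi i) (us k) @[k --> \oo] --> grad (phi i) zbar.
  move=> usz /(fintype.subsetP JtJ) iJ.
  have [_ _ cg] := nbhs_singleton (phi_C1 i iJ).
  exact: (cvg_comp us (grad (phi i)) usz cg).
have indJt : lin_indep Jt (fun i => grad (phi i) zbar).
  exact/free_imageP/(basis_free basisJt).
(* [zbar] itself belongs to the neighbourhood of constant rank. *)
have dimr : r = #|Jt|.
  rewrite -(nbhs_singleton rank_r) -(span_basis basisJt).
  by have /eqP -> := basis_free basisJt; rewrite size_map -cardE.
pose K := 'I_(p + q).+1.
have reduced : \forall k \near \oo, exists s : (K -> 'rV[R]_n) * {set K} * (K -> R),
    independent_rep phi box zbar Jt (zs k) (ws k) s.1.1 s.1.2 s.2.
  have near_eqk : \forall k \near \oo, eq_subdiff_at phi box (zs k) := zsz _ near_eq.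
  have near_rank : \forall k \near \oo,
      \dim <<[seq grad (phi i) (zs k) | i in eq_idx p q]>>%VS = r := zsz _ rank_r.
  have near_ind := lin_indep_near (fun i => gradJ zs i zsz) indJt.
  apply: filterS3 near_eqk near_rank near_ind => k eqk rankk indk.
  have [|xi [T [d rep]]] := Mbar_independent JtJ eqk indk _ (wP k).
    by rewrite rankk dimr.
  by exists (xi, T, d).
have [N _ NP] := reduced.
have /ex_choice[s sP] : forall k, exists s : (K -> 'rV[R]_n) * {set K} * (K -> R),
    independent_rep phi box zbar Jt (zs (k + N)%N) (ws (k + N)%N) s.1.1 s.1.2 s.2.
  by move=> k; apply: NP; exact: leq_addl.
(* Along a subsequence the remaining active set [T] is constant and the
   subgradients of all active constraints converge; those outside [T] are needed
   because the limit must provide a subgradient for every active index. *)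
have [T [f Tf]] := finType_subseq (fun k => (s k).1.2).
have [|g gge [xi xiP]] := @bounded_subseq_fam R K (active phi zbar) n
    (fun j => (s (f j)).1.1).
  move=> i iA; have [M subM] := subdiff_bounded box (lip i).
  exists M.
  have : \forall j \near \oo, forall y, subdiff box (phi i) (zs (f j + N)%N) y -> `|y| <= M.
    apply: (@subseq_cvg _ (fun j => f j + N)%N zs zbar _ zsz _ subM) => j.
    by apply: leq_trans (leq_addr _ _); case: (Tf j).
  by apply: filterS => j; apply; case: (sP (f j)) => + _ _ _ _; apply.
pose h j := (f (g j) + N)%N.
have hge j : (j <= h j)%N.
  by apply: leq_trans (leq_addr _ _); case: (Tf (g j)) => /(leq_trans (gge j)).
pose x j := (s (f (g j))).1.1; pose d j := (s (f (g j))).2.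
have hP j : independent_rep phi box zbar Jt (zs (h j)) (ws (h j)) (x j) T (d j).
  by rewrite -(proj2 (Tf (g j))); exact: sP.
have zhz := subseq_cvg hge zsz.
have xiA i : i \in active phi zbar -> subdiff box (phi i) zbar (xi i).
  move=> iA; apply: (subdiff_closed (lip i) zhz (xiP i iA)) => j.
  by case: (hP j) => + _ _ _ _; apply.
have TA : T \subset active phi zbar by case: (hP 0%N).
have JtA i : i \in Jt -> i \in active phi zbar = false.
  by move=> /(fintype.subsetP JtJ)/eq_notin_active/negbTE; apply.
have TJt : {in T, forall i, i \notin Jt}.
  by move=> i /(fintype.subsetP TA) iA; apply/negP => /JtA; rewrite iA.
have gen_cvg i : i \in T :|: Jt ->
    generators phi zbar (zs (h j)) (x j) i @[j --> \oo] --> generators phi zbar zbar xi i.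
  rewrite inE => /orP[iT|iJt].
    by rewrite /generators (fintype.subsetP TA _ iT); apply: xiP; exact: (fintype.subsetP TA).
  by rewrite /generators JtA //; exact: gradJ.
have sum_cvg : \sum_(i in T :|: Jt) d j i *: generators phi zbar (zs (h j)) (x j) i
    @[j --> \oo] --> w.
  have E j : \sum_(i in T :|: Jt) d j i *: generators phi zbar (zs (h j)) (x j) i =
      ws (h j) by case: (hP j).
  by under eq_cvg do rewrite E; exact: subseq_cvg.
have [f' [t [c [f'ge t0 cP cases]]]] := coef_limit gen_cvg sum_cvg.
have c0 i : i \in T -> 0 <= c i.
  move=> iT; apply: (@cvg_ge0 _ _ _ (cP i _)); first by rewrite inE iT.
  by apply: nearW => j; rewrite mulr_ge0 //; case: (hP (f' j)) => _ _ + _ _; apply.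
case: cases => [<-|[[i iTJ ci] sum0]].
  exact: (Mbar_of_generators TA JtJ (nbhs_singleton near_eq) xiA c0).
(* Unbounded multipliers: the limit vectors are positively dependent, hence the
   vectors themselves should be dependent eventually, against their choice. *)
have dep : pos_lin_dep T Jt xi (fun i => grad (phi i) zbar).
  exists c, c; split => //.
    by move: iTJ; rewrite inE => /orP[iT|iJt]; [left|right]; exists i.
  rewrite -[RHS]sum0 sum_setU //; congr (_ + _); apply: eq_bigr => k kT.
    by rewrite /generators (fintype.subsetP TA _ kT).
  by rewrite /generators JtA.
have [|||M _ MP] := constJt T xi TA _ dep (fun j => zs (h j)) x zhz.
- by move=> k /(fintype.subsetP TA); exact: xiA.
- by move=> k /(fintype.subsetP TA); exact: xiP.
- move=> j k /(fintype.subsetP TA) kA; case: (hP j) => + _ _ _ _; exact.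
have /negP[] := MP M (leqnn _).
apply/free_cat_imageP => //; case: (hP M) => _ _ _ + _; apply: eq_lin_indep => k.
rewrite inE /generators; case: (boolP (k \in T)) => [kT _|_ /= kJt].
  by rewrite (fintype.subsetP TA).
by rewrite JtA.
Qed.
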